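(* Let $L>0$. Then $L\in\mathcal N_D$ if and only if $L=L_n$ for some $n\in\mathbb N$, where $L_n>0$ is given by $$L_n^2=4a_n^2\,(e^{-6a_n}-1),$$ with $a_n<0$ being uniquely determined by $$b_n\cos b_n+a_n\sin b_n=0,$$ where $b_n$ satisfies $$\pi+2n\pi<b_n<\frac{3\pi}{2}+2n\pi\qquad\text{and}\qquad b_n^2=4a_n^2\left(e^{-6a_n}-\frac14\right).$$
   Context: $\mathbb N=\{0,1,2,\dots\}$. The set of critical lengths $\mathcal N_D$ is the set of $L>0$ for which there exist $z_1,z_2\in\mathbb C$ with $$z_1e^{z_1}=z_2e^{z_2}=-(z_1+z_2)e^{-(z_1+z_2)}\quad\text{and}\quad L^2=-(z_1^2+z_1z_2+z_2^2).$$ The statement includes that, for each $n\in\mathbb N$, the conditions on $(a_n,b_n)$ determine $a_n<0$ (and hence $b_n$) uniquely. *)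

(* Defs.v *)
From Stdlib Require Import Reals.
From Coquelicot Require Import Coquelicot.
Open Scope R_scope.

(** The complex exponential, [e^(x + i y) = e^x (cos y + i sin y)]. *)
Definition Cexp (z : C) : C := (exp (Re z) * cos (Im z), exp (Re z) * sin (Im z)).

Lemma Cexp_RtoC (x : R) : Cexp (RtoC x) = RtoC (exp x).
Proof.
unfold Cexp, RtoC; simpl; rewrite cos_0, sin_0.
now rewrite Rmult_1_r, Rmult_0_r.
Qed.

Lemma Cexp_plus (z w : C) : Cexp (z + w)%C = (Cexp z * Cexp w)%C.
Proof.
destruct z as [x y], w as [u v]; unfold Cexp, Cmult; simpl.
rewrite exp_plus, cos_plus, sin_plus; f_equal; ring.
Qed.

Definition critical_length (L : R) : Prop :=
  0 < L /\
  exists z1 z2 : C,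
    (z1 * Cexp z1 = z2 * Cexp z2)%C /\
    (z2 * Cexp z2 = - (z1 + z2) * Cexp (- (z1 + z2)))%C /\
    RtoC (L ^ 2) = (- (z1 ^ 2 + z1 * z2 + z2 ^ 2))%C.

Definition critical_pair (n : nat) (a b : R) : Prop :=
  a < 0 /\
  b * cos b + a * sin b = 0 /\
  PI + 2 * INR n * PI < b < 3 * PI / 2 + 2 * INR n * PI /\
  b ^ 2 = 4 * a ^ 2 * (exp (- 6 * a) - 1 / 4).

(* Main.v *)
Require Import Defs.
From Stdlib Require Import Reals Lra Ranalysis5.
From Coquelicot Require Import Coquelicot.
Open Scope R_scope.

(** Put [z3 = - (z1 + z2)] and [z_j = x_j + i y_j].  The three numbers have sum
    zero, a common value of [z e^z], and [z1 z2 + z2 z3 + z3 z1 = L^2].  That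
    this last number is real says that the vectors [x] and [y] are orthogonal
    in the plane of vectors of sum zero, and its value says
    [|y|^2 - |x|^2 = 2 L^2 > 0].  Orthogonality in a plane expresses [y_j^2] as
    an affine function of [x_j^2], the same for every [j]; hence the equality
    of the three moduli [|z_j e^(z_j)|] says that one function
    [(M - K x^2) e^(2 x)], with [K > 0], takes the same positive value at
    [x_1], [x_2] and [x_3].  Such a function is increasing and then decreasing
    where it is positive, so that two of the [x_j] coincide
    ([two_real_parts_coincide]).  Orthogonality then forces the triple to be
    [a + i b], [a - i b], [-2 a] ([conjugate_of_equal_real_parts]).

    For such a triple the imaginary part of [z e^z] gives
    [b cos b + a sin b = 0], its real part gives
    [a cos b - b sin b = - 2 a e^(-3 a)], and [L^2 = b^2 - 3 a^2].  The sum of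
    the squares of the first two equations is the relation between [b^2] and
    [a]; positivity of [L^2] gives [a < 0], and then the signs of [sin b] and
    [cos b] place [b > 0] in the third quadrant, modulo [2 PI].

    Finally, in the third quadrant, [a] can be eliminated by
    [a = - b cot b], and what remains is the single equation
    [- 2 cos b e^(3 b cot b) = 1], whose left-hand side strictly decreases
    through the value 1 once in each period. *)

(** * The third quadrant *)

Definition third_quadrant (n : nat) (b : R) : Prop :=
  PI + 2 * INR n * PI < b < 3 * PI / 2 + 2 * INR n * PI.

Lemma third_quadrant_signs (n : nat) (b : R) :
  third_quadrant n b -> PI < b /\ sin b < 0 /\ cos b < 0.
Proof.
intros [H1 H2].
pose proof PI_RGT_0 as HP; pose proof (pos_INR n) as Hn.
replace b with ((b - 2 * INR n * PI) + 2 * INR n * PI) by ring.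
rewrite sin_period, cos_period.
split; [nra|split].
- apply sin_lt_0; lra.
- apply cos_lt_0; lra.
Qed.

Lemma third_quadrant_of_signs (b : R) :
  0 < b -> sin b < 0 -> cos b < 0 -> exists n, third_quadrant n b.
Proof.
intros Hb Hs Hc.
pose proof PI_RGT_0 as HP.
assert (Hq : 0 <= b / (2 * PI)) by (apply Rlt_le, Rdiv_lt_0_compat; lra).
destruct (nfloor_ex _ Hq) as [n [H1 H2]].
exists n; unfold third_quadrant.
assert (E : b / (2 * PI) * (2 * PI) = b) by (field; lra).
assert (L1 : 2 * INR n * PI <= b) by nra.
assert (L2 : b < 2 * INR n * PI + 2 * PI) by nra.
replace b with ((b - 2 * INR n * PI) + 2 * INR n * PI) in Hs, Hc by ring.
rewrite sin_period in Hs; rewrite cos_period in Hc.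
split.
- destruct (Rlt_le_dec (PI + 2 * INR n * PI) b) as [|G]; [easy|].
  assert (0 <= sin (b - 2 * INR n * PI)) by (apply sin_ge_0; lra); lra.
- destruct (Rlt_le_dec b (3 * PI / 2 + 2 * INR n * PI)) as [|G]; [easy|].
  assert (0 <= cos (b - 2 * INR n * PI)) by (apply cos_ge_0_3PI2; lra); lra.
Qed.

(** * Elimination of [a], and uniqueness and existence of the pairs *)

Definition alpha (b : R) : R := - b * cos b / sin b.

Definition profile (b : R) : R := - 2 * cos b * exp (- 3 * alpha b).

(** Multiplying [a^2 + b^2 = 4 a^2 e^(-6 a)] by [sin^2 b] and using
    [a sin b = - b cos b] leaves [(2 cos b e^(-3 a))^2 = 1]; the sign of the
    cosine selects the square root. *)
Lemma critical_pair_iff_profile (n : nat) (a b : R) :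
  critical_pair n a b <->
  third_quadrant n b /\ a = alpha b /\ profile b = 1.
Proof.
unfold critical_pair; fold (third_quadrant n b).
assert (E : exp (- 6 * a) = exp (- 3 * a) * exp (- 3 * a))
  by (rewrite <- exp_plus; f_equal; ring).
rewrite E; pose proof (exp_pos (- 3 * a)) as He.
split.
- intros (Ha & Hab & Hq & Hb).
  destruct (third_quadrant_signs n b Hq) as (Hpi & Hs & Hc).
  pose proof PI_RGT_0 as HP.
  assert (Ea : a = alpha b)
    by (unfold alpha; apply Rmult_eq_reg_r with (sin b); [field_simplify|]; lra).
  split; [easy|split; [easy|]].
  unfold profile; rewrite <- Ea.
  set (e := exp (- 3 * a)) in *.
  pose proof (sin2_cos2 b) as SC; unfold Rsqr in SC.
  assert (Hb2 : b ^ 2 * ((2 * cos b * e) ^ 2 - 1) = 0).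
  { transitivity (4 * (a * sin b) ^ 2 * e ^ 2 - (a * sin b) ^ 2 - b ^ 2 * sin b ^ 2).
    - replace (a * sin b) with (- (b * cos b)) by lra.
      replace 1 with (sin b * sin b + cos b * cos b) by lra; ring.
    - replace (b ^ 2 * sin b ^ 2)
        with (4 * a ^ 2 * (e * e - 1 / 4) * sin b ^ 2) by (rewrite Hb; ring).
      field. }
  assert (Hsq : (2 * cos b * e) ^ 2 - 1 = 0).
  { apply Rmult_integral in Hb2; destruct Hb2 as [Z|Z]; [|easy].
    exfalso; nra. }
  assert (0 < - (cos b * e)) by nra.
  nra.
- intros (Hq & Ea & Hp).
  destruct (third_quadrant_signs n b Hq) as (Hpi & Hs & Hc).
  pose proof PI_RGT_0 as HP.
  unfold profile in Hp; rewrite <- Ea in Hp.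
  set (e := exp (- 3 * a)) in *.
  assert (Hab : a * sin b = - b * cos b) by (rewrite Ea; unfold alpha; field; lra).
  pose proof (sin2_cos2 b) as SC; unfold Rsqr in SC.
  split; [|split; [lra|split; [easy|]]].
  + assert (0 < a * sin b) by (rewrite Hab; nra); nra.
  + apply Rmult_eq_reg_r with (sin b ^ 2); [|nra].
    replace (4 * a ^ 2 * (e * e - 1 / 4) * sin b ^ 2)
      with ((a * sin b) ^ 2 * (4 * e * e - 1)) by field.
    rewrite Hab.
    replace ((- b * cos b) ^ 2 * (4 * e * e - 1))
      with (b ^ 2 * ((- 2 * cos b * e) ^ 2 - cos b * cos b)) by ring.
    rewrite Hp; replace (1 ^ 2) with (sin b * sin b + cos b * cos b) by lra.
    ring.
Qed.

(** Both factors of the profile decrease: [- cos] because [sin < 0], and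
    [b cot b] because its derivative is [(sin b cos b - b) / sin^2 b]. *)
Lemma profile_decreasing (n : nat) (b c : R) :
  third_quadrant n b -> third_quadrant n c -> b < c -> profile c < profile b.
Proof.
intros Hb Hc Hbc.
set (d := fun x => 2 * sin x * exp (- 3 * alpha x)
  - 2 * cos x * (3 * ((sin x * cos x - x) / sin x ^ 2)) * exp (- 3 * alpha x)).
assert (Hin : forall x, b <= x <= c -> third_quadrant n x)
  by (unfold third_quadrant in *; intros; lra).
assert (Hd : forall x, b <= x <= c -> is_derive profile x (d x)).
{ intros x Hx; destruct (third_quadrant_signs n x (Hin x Hx)) as (_ & Hs & _).
  unfold profile, d, alpha; auto_derive; [lra|].
  pose proof (sin2_cos2 x) as SC; unfold Rsqr in SC.
  replace ((sin x * cos x - x) / sin x ^ 2)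
    with ((sin x * cos x - x * (sin x * sin x + cos x * cos x)) / sin x ^ 2)
    by (rewrite SC, Rmult_1_r; reflexivity).
  unfold Rdiv; field; lra. }
destruct (MVT_gen profile b c d) as (x & Hx & E).
- rewrite Rmin_left, Rmax_right by lra; intros; apply Hd; lra.
- rewrite Rmin_left, Rmax_right by lra; intros y Hy.
  apply continuity_pt_filterlim, (ex_derive_continuous profile).
  exists (d y); apply Hd; lra.
- rewrite Rmin_left, Rmax_right in Hx by lra.
  destruct (third_quadrant_signs n x (Hin x Hx)) as (Hpi & Hs & Hco).
  pose proof PI2_1 as HP.
  assert (Hneg : d x < 0).
  { unfold d; pose proof (exp_pos (- 3 * alpha x)) as He.
    assert (Hq : (sin x * cos x - x) / sin x ^ 2 < 0).
    { apply Rdiv_neg_pos; [|nra].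
      pose proof (sin2_cos2 x) as SC; unfold Rsqr in SC; nra. }
    set (q := (sin x * cos x - x) / sin x ^ 2) in *.
    assert (0 < cos x * q) by nra. nra. }
  nra.
Qed.

(** The value exceeds [1] at [4 PI / 3], where [- 2 cos] is [1] and the
    exponent is positive, and it is [0] at [3 PI / 2]. *)
Lemma profile_attains_one (n : nat) :
  {b : R | third_quadrant n b /\ profile b = 1}.
Proof.
pose proof PI_RGT_0 as HP; pose proof (pos_INR n) as Hn.
set (l := 4 * (PI / 3) + 2 * INR n * PI).
set (r := 3 * (PI / 2) + 2 * INR n * PI).
assert (Hsin : forall x, l <= x <= r -> sin x < 0).
{ intros x Hx; unfold l, r in Hx.
  replace x with ((x - 2 * INR n * PI) + 2 * INR n * PI) by ring.
  rewrite sin_period; apply sin_lt_0; lra. }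
assert (Hl : 1 < profile l).
{ destruct (third_quadrant_signs n l) as (Hpi & Hs & Hc);
    [unfold third_quadrant, l; lra|].
  assert (Ec : cos l = - 1 / 2).
  { unfold l; rewrite cos_period.
    replace (4 * (PI / 3)) with (PI / 3 + PI) by field.
    rewrite neg_cos, cos_PI3; field. }
  unfold profile.
  assert (Ha : alpha l < 0).
  { unfold alpha; apply Rdiv_pos_neg; [nra|easy]. }
  pose proof (exp_ineq1 (- 3 * alpha l)); rewrite Ec; lra. }
assert (Hr : profile r = 0).
{ unfold profile, r; rewrite cos_period, cos_3PI2; ring. }
destruct (IVT_interv (fun x => 1 - profile x) l r) as (b & Hb & E).
- intros x Hx.
  apply continuity_pt_filterlim, (ex_derive_continuous (fun x => 1 - profile x)).
  unfold profile, alpha; auto_derive; pose proof (Hsin x Hx); lra.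
- unfold l, r; lra.
- lra.
- rewrite Hr; lra.
- exists b; split; [|lra].
  assert (b <> r) by (intros ->; lra).
  unfold third_quadrant; unfold l, r in *; lra.
Qed.

Lemma critical_pair_exists (n : nat) :
  {p : R * R | critical_pair n (fst p) (snd p)}.
Proof.
destruct (profile_attains_one n) as (b & Hq & Hp).
exists (alpha b, b); now apply critical_pair_iff_profile.
Qed.

Lemma critical_pair_unique (n : nat) (a b a' b' : R) :
  critical_pair n a b -> critical_pair n a' b' -> a' = a /\ b' = b.
Proof.
rewrite !critical_pair_iff_profile; intros (Q & -> & P) (Q' & -> & P').
enough (b' = b) by (subst; easy).
destruct (Rtotal_order b' b) as [H|[H|H]]; [|easy|].
- pose proof (profile_decreasing n b' b Q' Q H); lra.
- pose proof (profile_decreasing n b b' Q Q' H); lra.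
Qed.

(** * From pairs to critical lengths *)

(** Both sides equal [- b / sin b]: the left one by [a sin b = - b cos b], the
    right one because moreover [- 2 cos b e^(-3 a) = 1]. *)
Lemma critical_pair_real_part (n : nat) (a b : R) :
  critical_pair n a b ->
  a * cos b - b * sin b = - 2 * a * exp (- 3 * a).
Proof.
intros H; apply critical_pair_iff_profile in H; destruct H as (Q & Ea & P).
destruct (third_quadrant_signs n b Q) as (_ & Hs & _).
pose proof (sin2_cos2 b) as SC; unfold Rsqr in SC.
unfold profile in P; rewrite <- Ea in P.
assert (Hab : a * sin b = - b * cos b) by (rewrite Ea; unfold alpha; field; lra).
apply Rmult_eq_reg_r with (sin b); [|lra].
transitivity (- b * (sin b * sin b + cos b * cos b)).
- replace ((a * cos b - b * sin b) * sin b)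
    with (a * sin b * cos b - b * (sin b * sin b)) by ring.
  rewrite Hab; ring.
- rewrite SC, <- P.
  replace (- 2 * a * exp (- 3 * a) * sin b)
    with (- 2 * (a * sin b) * exp (- 3 * a)) by ring.
  rewrite Hab; ring.
Qed.

Lemma pair_length_pos (n : nat) (a b : R) :
  critical_pair n a b -> 0 < 4 * a ^ 2 * (exp (- 6 * a) - 1).
Proof.
intros (Ha & _).
pose proof (exp_ineq1 (- 6 * a)).
apply Rmult_lt_0_compat; [nra|lra].
Qed.

Lemma critical_length_of_pair (n : nat) (a b L : R) :
  critical_pair n a b -> 0 < L -> L ^ 2 = 4 * a ^ 2 * (exp (- 6 * a) - 1) ->
  critical_length L.
Proof.
intros H HL EL.
pose proof (critical_pair_real_part n a b H) as Hre.
destruct H as (Ha & Him & _ & Hb).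
split; [easy|exists (a, b), (a, - b)].
assert (E3 : exp (- 2 * a) = exp a * exp (- 3 * a))
  by (rewrite <- exp_plus; f_equal; ring).
unfold Cexp, Cmult, Cplus, Copp, RtoC; simpl.
rewrite cos_neg, sin_neg.
replace (- (a + a)) with (- 2 * a) by ring.
replace (- (b + - b)) with 0 by ring.
rewrite cos_0, sin_0, E3.
split; [|split]; f_equal.
- ring.
- replace (a * (exp a * sin b) + b * (exp a * cos b))
    with (exp a * (b * cos b + a * sin b)) by ring.
  replace (a * (exp a * - sin b) + - b * (exp a * cos b))
    with (- exp a * (b * cos b + a * sin b)) by ring.
  rewrite Him; ring.
- replace (a * (exp a * cos b) - - b * (exp a * - sin b))
    with (exp a * (a * cos b - b * sin b)) by ring.
  rewrite Hre; ring.
- replace (a * (exp a * - sin b) + - b * (exp a * cos b))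
    with (- exp a * (b * cos b + a * sin b)) by ring.
  rewrite Him; ring.
- simpl in *; lra.
- ring.
Qed.

(** * From critical lengths to pairs *)

(** The condition on [z1], [z2] in a form invariant under permutation, for
    [z3 = - (z1 + z2)]. *)
Definition resonant (L : R) (z1 z2 z3 : C) : Prop :=
  (z1 + z2 + z3 = 0)%C /\
  (z1 * Cexp z1 = z2 * Cexp z2)%C /\
  (z2 * Cexp z2 = z3 * Cexp z3)%C /\
  (z1 * z2 + z2 * z3 + z3 * z1 = RtoC (L ^ 2))%C.

Lemma critical_length_resonant (L : R) :
  critical_length L -> exists z1 z2 z3, resonant L z1 z2 z3.
Proof.
intros (_ & z1 & z2 & H1 & H2 & H3).
exists z1, z2, (- (z1 + z2))%C.
split; [ring|split; [easy|split; [easy|]]].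
rewrite H3; ring.
Qed.

Lemma resonant_rotate (L : R) (z1 z2 z3 : C) :
  resonant L z1 z2 z3 -> resonant L z2 z3 z1.
Proof.
intros (H0 & H1 & H2 & H3).
split; [rewrite <- H0; ring|split; [easy|split; [congruence|]]].
rewrite <- H3; ring.
Qed.

Lemma resonant_cartesian (L x1 y1 x2 y2 x3 y3 : R) :
  resonant L (x1, y1) (x2, y2) (x3, y3) ->
  x1 + x2 + x3 = 0 /\ y1 + y2 + y3 = 0 /\
  x1 * y1 + x2 * y2 + x3 * y3 = 0 /\
  (y1 ^ 2 + y2 ^ 2 + y3 ^ 2) - (x1 ^ 2 + x2 ^ 2 + x3 ^ 2) = 2 * L ^ 2.
Proof.
intros (H0 & _ & _ & H3).
unfold Cplus, Cmult, RtoC in H0, H3; simpl in H0, H3.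
injection H0 as HX HY; injection H3 as HR HI.
assert (x3 = - x1 - x2) by lra; assert (y3 = - y1 - y2) by lra; subst x3 y3.
repeat split; nra.
Qed.

Lemma modulus_equal (x y u v : R) :
  ((x, y) * Cexp (x, y) = (u, v) * Cexp (u, v))%C ->
  (x ^ 2 + y ^ 2) * exp (2 * x) = (u ^ 2 + v ^ 2) * exp (2 * u).
Proof.
assert (M : forall s t, (s ^ 2 + t ^ 2) * exp (2 * s) =
  fst ((s, t) * Cexp (s, t))%C ^ 2 + snd ((s, t) * Cexp (s, t))%C ^ 2).
{ intros s t; unfold Cmult, Cexp; simpl.
  replace (2 * s) with (s + s) by ring; rewrite exp_plus.
  pose proof (sin2_cos2 t) as SC; unfold Rsqr in SC.
  transitivity ((s ^ 2 + t ^ 2) * (exp s * exp s)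
    * (sin t * sin t + cos t * cos t)); [rewrite SC; ring|ring]. }
intros H; rewrite (M x y), (M u v), H; easy.
Qed.

(** Two applications of Rolle's theorem yield critical points [c1 < c2], that
    is, roots of [K c^2 + K c = M].  Their sum is [-1], so [c1 < 0]; then
    [c1^2 < x1^2] gives [M - K c1^2 > 0], whereas this number is [K c1]. *)
Lemma bump_not_three_times (M K x1 x2 x3 : R) :
  0 < K -> x1 < x2 -> x2 < x3 ->
  0 < (M - K * x1 ^ 2) * exp (2 * x1) ->
  (M - K * x1 ^ 2) * exp (2 * x1) = (M - K * x2 ^ 2) * exp (2 * x2) ->
  (M - K * x2 ^ 2) * exp (2 * x2) = (M - K * x3 ^ 2) * exp (2 * x3) ->
  False.
Proof.
intros HK H12 H23 Hpos E12 E23.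
assert (Rolle : forall u v, u < v ->
  (M - K * u ^ 2) * exp (2 * u) = (M - K * v ^ 2) * exp (2 * v) ->
  exists c, u < c < v /\ M - K * c ^ 2 = K * c).
{ intros u v Huv E.
  destruct (MVT_cor2 (fun x => (M - K * x ^ 2) * exp (2 * x))
    (fun x => 2 * (M - K * x ^ 2 - K * x) * exp (2 * x)) u v Huv)
    as (c & Hc & Hin).
  - intros c _; apply is_derive_Reals; auto_derive; [easy|ring].
  - exists c; split; [easy|].
    rewrite E, Rminus_diag in Hc.
    pose proof (exp_pos (2 * c)).
    symmetry in Hc; apply Rmult_integral in Hc; destruct Hc as [Hc|Hc]; [|lra].
    apply Rmult_integral in Hc; destruct Hc; lra. }
destruct (Rolle x1 x2 H12 E12) as (c1 & Hc1 & R1).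
destruct (Rolle x2 x3 H23 E23) as (c2 & Hc2 & R2).
assert (Hsum : c1 + c2 = - 1).
{ assert (K * ((c2 - c1) * (c1 + c2 + 1)) = 0) as Z by nra.
  apply Rmult_integral in Z; destruct Z as [Z|Z]; [lra|].
  apply Rmult_integral in Z; destruct Z; lra. }
assert (0 < M - K * x1 ^ 2) by (pose proof (exp_pos (2 * x1)); nra).
assert (c1 < 0) by lra.
assert (c1 ^ 2 < x1 ^ 2) by nra.
nra.
Qed.

(** If [x] and [y] are orthogonal in the plane of sum zero, then
    [x / |x|, y / |y|] is an orthonormal basis of it, and the projection of a
    coordinate vector to the plane, of squared length [2/3], satisfies
    Pythagoras. *)
Lemma orthogonal_coordinates (x1 x2 x3 y1 y2 y3 : R) :
  x1 + x2 + x3 = 0 -> y1 + y2 + y3 = 0 -> x1 * y1 + x2 * y2 + x3 * y3 = 0 ->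
  (x1 ^ 2 + x2 ^ 2 + x3 ^ 2) * y1 ^ 2 + (y1 ^ 2 + y2 ^ 2 + y3 ^ 2) * x1 ^ 2 =
  2 / 3 * ((x1 ^ 2 + x2 ^ 2 + x3 ^ 2) * (y1 ^ 2 + y2 ^ 2 + y3 ^ 2)).
Proof.
intros HX HY HS.
(* The identity for arbitrary [x], [y], with Gram correction terms. *)
assert (G : (x1 ^ 2 + x2 ^ 2 + x3 ^ 2) * y1 ^ 2
    + (y1 ^ 2 + y2 ^ 2 + y3 ^ 2) * x1 ^ 2
    - 2 * (x1 * y1 + x2 * y2 + x3 * y3) * x1 * y1 =
  2 / 3 * ((x1 ^ 2 + x2 ^ 2 + x3 ^ 2) * (y1 ^ 2 + y2 ^ 2 + y3 ^ 2)
    - (x1 * y1 + x2 * y2 + x3 * y3) ^ 2)).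
{ replace x3 with (- x1 - x2) by lra; replace y3 with (- y1 - y2) by lra.
  field. }
rewrite HS in G; lra.
Qed.

(** A vanishing member would make all [z e^z], hence all [z], vanish. *)
Lemma resonant_nonzero (L x1 y1 x2 y2 x3 y3 : R) :
  0 < L -> resonant L (x1, y1) (x2, y2) (x3, y3) -> 0 < x1 ^ 2 + y1 ^ 2.
Proof.
intros HL H.
destruct (resonant_cartesian _ _ _ _ _ _ _ H) as (_ & _ & _ & HD).
destruct H as (_ & H12 & H23 & _).
apply modulus_equal in H12; apply modulus_equal in H23.
destruct (Rlt_le_dec 0 (x1 ^ 2 + y1 ^ 2)) as [|Hle]; [easy|exfalso].
assert (Z1 : x1 ^ 2 + y1 ^ 2 = 0) by nra.
rewrite Z1, Rmult_0_l in H12; rewrite <- H12 in H23.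
pose proof (exp_pos (2 * x2)); pose proof (exp_pos (2 * x3)).
assert (Z2 : x2 ^ 2 + y2 ^ 2 = 0).
{ symmetry in H12; apply Rmult_integral in H12; destruct H12; lra. }
assert (Z3 : x3 ^ 2 + y3 ^ 2 = 0).
{ symmetry in H23; apply Rmult_integral in H23; destruct H23; lra. }
nra.
Qed.

(** By [orthogonal_coordinates], [|x|^2 |z_j|^2 = M - K x_j^2] with
    [M = 2/3 |x|^2 |y|^2] and [K = |y|^2 - |x|^2 = 2 L^2], so that the equality
    of the moduli of [z e^z] contradicts [bump_not_three_times] if the [x_j]
    are distinct. *)
Lemma two_real_parts_coincide (L x1 y1 x2 y2 x3 y3 : R) :
  0 < L -> resonant L (x1, y1) (x2, y2) (x3, y3) ->
  x1 = x2 \/ x2 = x3 \/ x3 = x1.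
Proof.
intros HL H.
pose proof (resonant_nonzero _ _ _ _ _ _ _ HL H) as N1.
pose proof (resonant_nonzero _ _ _ _ _ _ _ HL
  (resonant_rotate _ _ _ _ H)) as N2.
pose proof (resonant_nonzero _ _ _ _ _ _ _ HL
  (resonant_rotate _ _ _ _ (resonant_rotate _ _ _ _ H))) as N3.
destruct (resonant_cartesian _ _ _ _ _ _ _ H) as (HX & HY & HS & HD).
destruct H as (_ & H12 & H23 & _).
apply modulus_equal in H12; apply modulus_equal in H23.
pose proof (orthogonal_coordinates x1 x2 x3 y1 y2 y3 HX HY HS) as O1.
pose proof (orthogonal_coordinates x2 x3 x1 y2 y3 y1 ltac:(lra) ltac:(lra)
  ltac:(lra)) as O2.
pose proof (orthogonal_coordinates x3 x1 x2 y3 y1 y2 ltac:(lra) ltac:(lra)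
  ltac:(lra)) as O3.
set (X := x1 ^ 2 + x2 ^ 2 + x3 ^ 2) in *.
set (Y := y1 ^ 2 + y2 ^ 2 + y3 ^ 2) in *.
replace (x2 ^ 2 + x3 ^ 2 + x1 ^ 2) with X in O2 by (unfold X; ring).
replace (y2 ^ 2 + y3 ^ 2 + y1 ^ 2) with Y in O2 by (unfold Y; ring).
replace (x3 ^ 2 + x1 ^ 2 + x2 ^ 2) with X in O3 by (unfold X; ring).
replace (y3 ^ 2 + y1 ^ 2 + y2 ^ 2) with Y in O3 by (unfold Y; ring).
destruct (Req_dec x1 x2) as [|D12]; [now left|].
destruct (Req_dec x2 x3) as [|D23]; [now right; left|].
destruct (Req_dec x3 x1) as [|D31]; [now right; right|exfalso].
assert (PX : 0 < X) by (unfold X; nra).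
assert (HK : 0 < 2 * L ^ 2) by nra.
set (M := 2 / 3 * (X * Y)) in *; set (K := 2 * L ^ 2) in *.
assert (F : forall x y, X * y ^ 2 + Y * x ^ 2 = M ->
  (M - K * x ^ 2) * exp (2 * x) = X * ((x ^ 2 + y ^ 2) * exp (2 * x))).
{ intros x y <-; rewrite <- HD; ring. }
pose proof (F _ _ O1) as F1; pose proof (F _ _ O2) as F2.
pose proof (F _ _ O3) as F3.
assert (P : forall x y, 0 < x ^ 2 + y ^ 2 ->
  0 < X * ((x ^ 2 + y ^ 2) * exp (2 * x))).
{ intros; repeat apply Rmult_lt_0_compat; auto using exp_pos. }
pose proof (P _ _ N1) as P1; pose proof (P _ _ N2) as P2.
pose proof (P _ _ N3) as P3.
rewrite <- F1 in P1; rewrite <- F2 in P2; rewrite <- F3 in P3.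
rewrite <- H23 in F3; rewrite <- H12 in F2, F3.
destruct (Rdichotomy _ _ D12), (Rdichotomy _ _ D23), (Rdichotomy _ _ D31);
  try lra; unfold Rgt in *.
all: match goal with
  | A : ?u < ?v, B : ?v < ?w |- _ =>
    apply (bump_not_three_times M K u v w); auto; congruence
  end.
Qed.

(** With real parts [a], [a], [-2 a], orthogonality reads [a y3 = 0]; and
    [a = 0] is excluded because three imaginary numbers of equal modulus and
    sum zero vanish. *)
Lemma conjugate_of_equal_real_parts (L a y1 y2 x3 y3 : R) :
  0 < L -> resonant L (a, y1) (a, y2) (x3, y3) ->
  x3 = - 2 * a /\ y3 = 0 /\ y2 = - y1 /\ L ^ 2 = y1 ^ 2 - 3 * a ^ 2.
Proof.
intros HL H.
destruct (resonant_cartesian _ _ _ _ _ _ _ H) as (HX & HY & HS & HD).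
destruct H as (_ & H12 & H23 & _).
apply modulus_equal in H12; apply modulus_equal in H23.
assert (x3 = - 2 * a) by lra; subst x3.
assert (Z : a * y3 = 0) by nra.
assert (Y3 : y3 = 0).
{ apply Rmult_integral in Z; destruct Z as [->|]; [|easy].
  replace (2 * (- 2 * 0)) with (2 * 0) in H23 by ring.
  assert (Z : (y1 - y2) * (y1 + y2) = 0)
    by (apply Rmult_eq_reg_r with (exp (2 * 0)); [lra|apply Rgt_not_eq, exp_pos]).
  apply Rmult_integral in Z; destruct Z as [Z|Z]; [|lra].
  assert (y2 = y1) by lra; subst y2.
  assert (y3 = - 2 * y1) by lra; subst y3.
  assert (y1 ^ 2 = 0); [|nra].
  apply Rmult_eq_reg_r with (exp (2 * 0)); [lra|apply Rgt_not_eq, exp_pos]. }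
subst y3; assert (y2 = - y1) by lra; subst y2.
repeat split; nra.
Qed.

(** The sum of the squares of the two equations gives the relation for [b^2];
    then [L^2 > 0] gives [e^(-6 a) > 1]. *)
Lemma pair_of_equations (L a b : R) :
  0 < L -> 0 < b -> L ^ 2 = b ^ 2 - 3 * a ^ 2 ->
  b * cos b + a * sin b = 0 ->
  a * cos b - b * sin b = - 2 * a * exp (- 3 * a) ->
  exists n, critical_pair n a b /\ L ^ 2 = 4 * a ^ 2 * (exp (- 6 * a) - 1).
Proof.
intros HL Hb HLb Him Hre.
pose proof (sin2_cos2 b) as SC; unfold Rsqr in SC.
assert (E : exp (- 6 * a) = exp (- 3 * a) * exp (- 3 * a))
  by (rewrite <- exp_plus; f_equal; ring).
assert (Hsq : a ^ 2 + b ^ 2 = 4 * a ^ 2 * exp (- 6 * a)).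
{ transitivity ((b * cos b + a * sin b) ^ 2 + (a * cos b - b * sin b) ^ 2).
  - transitivity ((a ^ 2 + b ^ 2) * (sin b * sin b + cos b * cos b));
      [rewrite SC|]; ring.
  - rewrite Him, Hre, E; ring. }
assert (HL2 : L ^ 2 = 4 * a ^ 2 * (exp (- 6 * a) - 1)) by lra.
assert (Ha : a < 0).
{ destruct (Rlt_le_dec a 0) as [|Ha]; [easy|exfalso].
  assert (exp (- 6 * a) <= 1).
  { destruct Ha as [Ha| <-]; [|rewrite Rmult_0_r, exp_0; lra].
    rewrite <- exp_0; apply Rlt_le, exp_increasing; lra. }
  assert (0 <= 4 * a ^ 2) by nra; nra. }
pose proof (exp_pos (- 3 * a)) as He.
assert (Hs : sin b < 0).
{ assert (P : 0 < (a * cos b - b * sin b) * b).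
  { rewrite Hre; apply Rmult_lt_0_compat; [nra|easy]. }
  replace ((a * cos b - b * sin b) * b)
    with (a * (b * cos b + a * sin b) - (a ^ 2 + b ^ 2) * sin b) in P by ring.
  rewrite Him in P; assert (0 < a ^ 2 + b ^ 2) by nra; nra. }
assert (Hc : cos b < 0) by (assert (0 < a * sin b) by nra; nra).
destruct (third_quadrant_of_signs b Hb Hs Hc) as (n & Hn).
exists n; split; [|easy].
split; [easy|split; [easy|split; [exact Hn|lra]]].
Qed.

Lemma pair_of_equal_real_parts (L a y1 y2 x3 y3 : R) :
  0 < L -> resonant L (a, y1) (a, y2) (x3, y3) ->
  exists n b, critical_pair n a b /\ L ^ 2 = 4 * a ^ 2 * (exp (- 6 * a) - 1).
Proof.
intros HL H.
destruct (conjugate_of_equal_real_parts _ _ _ _ _ _ HL H) as (-> & -> & -> & HL2).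
destruct H as (_ & H12 & H23 & _).
rewrite <- H12 in H23; clear H12.
unfold Cexp, Cmult in H23; simpl in H23.
rewrite cos_0, sin_0 in H23; injection H23 as Hre Him.
assert (E : exp (- 2 * a) = exp a * exp (- 3 * a))
  by (rewrite <- exp_plus; f_equal; ring).
rewrite E in Hre, Him.
pose proof (exp_pos a) as He.
assert (Him' : y1 * cos y1 + a * sin y1 = 0).
{ apply Rmult_eq_reg_l with (exp a); lra. }
assert (Hre' : a * cos y1 - y1 * sin y1 = - 2 * a * exp (- 3 * a)).
{ apply Rmult_eq_reg_l with (exp a); lra. }
(* The equations are even in [y1], whose sign selects one of the two
   conjugate members. *)
destruct (Rtotal_order y1 0) as [Hy|[Hy|Hy]].
- destruct (pair_of_equations L a (- y1)) as (n & Hn);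
    rewrite ?cos_neg, ?sin_neg; try lra.
  now exists n, (- y1).
- exfalso; subst y1; nra.
- destruct (pair_of_equations L a y1) as (n & Hn); try lra.
  now exists n, y1.
Qed.

Lemma pair_of_critical_length (L : R) :
  critical_length L ->
  exists n a b, critical_pair n a b /\ L ^ 2 = 4 * a ^ 2 * (exp (- 6 * a) - 1).
Proof.
intros H; assert (HL : 0 < L) by apply H.
destruct (critical_length_resonant L H) as ([x1 y1] & [x2 y2] & [x3 y3] & Hr).
assert (G : exists a b1 b2 u v, resonant L (a, b1) (a, b2) (u, v)).
{ destruct (two_real_parts_coincide _ _ _ _ _ _ _ HL Hr) as [E|[E|E]].
  - subst x2; eauto 6.
  - subst x3; apply resonant_rotate in Hr; eauto 6.
  - subst x1; do 2 apply resonant_rotate in Hr; eauto 6. }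
destruct G as (a & b1 & b2 & u & v & G).
destruct (pair_of_equal_real_parts _ _ _ _ _ _ HL G) as (n & b & Hn).
now exists n, a, b.
Qed.

Theorem proposition1p1 :
  exists a b Lseq : nat -> R,
    (forall n : nat,
       critical_pair n (a n) (b n) /\
       (forall a' b' : R, critical_pair n a' b' -> a' = a n /\ b' = b n)) /\
    (forall n : nat,
       0 < Lseq n /\ Lseq n ^ 2 = 4 * a n ^ 2 * (exp (- 6 * a n) - 1)) /\
    (forall L : R, 0 < L ->
       (critical_length L <-> exists n : nat, L = Lseq n)).
Proof.
set (p := fun n => proj1_sig (critical_pair_exists n)).
assert (Hp : forall n, critical_pair n (fst (p n)) (snd (p n)))
  by (intros n; exact (proj2_sig (critical_pair_exists n))).
set (Lseq := fun n => sqrt (4 * fst (p n) ^ 2 * (exp (- 6 * fst (p n)) - 1))).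
assert (HLs : forall n, 0 < Lseq n /\
  Lseq n ^ 2 = 4 * fst (p n) ^ 2 * (exp (- 6 * fst (p n)) - 1)).
{ intros n; pose proof (pair_length_pos n _ _ (Hp n)) as Hpos.
  split; [now apply sqrt_lt_R0|now apply pow2_sqrt, Rlt_le]. }
exists (fun n => fst (p n)), (fun n => snd (p n)), Lseq.
split; [|split; [exact HLs|]].
- intros n; split; [exact (Hp n)|]; intros a' b' H'.
  exact (critical_pair_unique n _ _ _ _ (Hp n) H').
- intros L HL; split.
  + intros H; destruct (pair_of_critical_length L H) as (n & a & b & Hn & E).
    exists n; destruct (critical_pair_unique n _ _ _ _ (Hp n) Hn) as [-> _].
    destruct (HLs n) as [P Q]; rewrite <- Q in E; nra.
  + intros [n ->]; destruct (HLs n) as [P Q].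
    exact (critical_length_of_pair n _ _ _ (Hp n) P Q).
Qed.
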